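(* For every integer $r \geq 3$ and all sufficiently large $n$ (depending on $r$), $$n+\frac{1}{12r}n^{\frac{r-1}{r}} \leq h(r,n)\leq h'(r,n) \leq \frac{(r+1)n}{2}+3r^2n^{\frac{2r-1}{2r}}.$$
   Context: A hypergraph is $r$-uniform if every edge contains exactly $r$ vertices. An $r$-uniform hypergraph is $r$-partite if its vertex set can be partitioned into $r$ sets $V_1,\dots,V_r$ such that every edge contains exactly one vertex from each $V_i$. A matching is a set of pairwise vertex-disjoint edges. Given a collection (repetitions allowed) of matchings $M_1,\dots,M_n$ in a hypergraph, a matching $M\subseteq \bigcup_{i=1}^n M_i$ is rainbow if there is an injection $\phi:M\to[n]$ such that every edge $e\in M$ belongs to $M_{\phi(e)}$. $h(r,n)$ denotes the smallest integer $s$ such that every collection of $n$ matchings, each of size $s$, in an $r$-partite $r$-uniform hypergraph admits a rainbow matching of size $n$; $h'(r,n)$ is defined identically but for arbitrary (not necessarily $r$-partite) $r$-uniform hypergraphs. *)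

(* Defs.v *)
From Stdlib Require Import Reals ClassicalEpsilon.
From mathcomp Require Import all_boot.
Set Implicit Arguments. Unset Strict Implicit. Unset Printing Implicit Defensive.

Section Hyper.
Variable V : finType.

Definition uniform (r : nat) (E : {set {set V}}) : Prop :=
  forall e, e \in E -> #|e| = r.

Definition partite (r : nat) (E : {set {set V}}) : Prop :=
  exists f : V -> 'I_r, forall e, e \in E -> forall i : 'I_r,
    #|[set v in e | f v == i]| = 1.

Definition matching (M : {set {set V}}) : Prop :=
  forall e1 e2, e1 \in M -> e2 \in M -> e1 != e2 -> [disjoint e1 & e2].

Definition rainbow (n : nat) (Ms : 'I_n -> {set {set V}}) (R : {set {set V}}) : Prop :=
  matching R /\ R \subset \bigcup_(i < n) Ms i /\
  exists phi : {set V} -> 'I_n,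
    {in R &, injective phi} /\ (forall e, e \in R -> e \in Ms (phi e)).
End Hyper.

Definition union_edges (V : finType) (n : nat) (Ms : 'I_n -> {set {set V}}) :=
  \bigcup_(i < n) Ms i.

Definition good (part : bool) (r n s : nat) : Prop :=
  forall (V : finType) (Ms : 'I_n -> {set {set V}}),
    (forall i, matching (Ms i)) ->
    (forall i, #|Ms i| = s) ->
    uniform r (union_edges Ms) ->
    (part -> partite r (union_edges Ms)) ->
    exists R : {set {set V}}, rainbow Ms R /\ #|R| = n.

Definition hmin (part : bool) (r n : nat) : nat :=
  epsilon (inhabits 0%nat)
    (fun s => good part r n s /\ forall t, good part r n t -> (s <= t)%nat).

Definition h (r n : nat) : nat := hmin true r n.
Definition h' (r n : nat) : nat := hmin false r n.

(* Main.v *)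
(* Lower bound.  Take k disjoint copies of an r-partite block with t vertices available in each part, in
   which m^r >= n perfect matchings M_p, p : [r] -> [m], admit no rainbow matching of size t, where t is
   about r m.  The n matchings obtained have size k t, while a rainbow matching has at most k (t - 1) edges;
   with m about n^(1/r) and k about n / t the gap k is of order n^((r-1)/r) / r.

   Upper bound.  A random vertex set U of density about n^(-1/(2r)) / 4 contains many edges of every matching
   and meets few.  Outside U take a partial rainbow matching R with vertex set W.  If more than a few colours
   are unused, each of them has more than n + D edges meeting W in exactly one vertex, so it has two disjoint
   such edges at the same edge of R for at least D / (r - 1) edges of R.  By pigeonhole some e in R serves many
   unused colours in this way, and the set-pair inequality gives two of these colours with disjoint edges by
   which e can be replaced, enlarging R.  The few colours left over at the end are served greedily inside U. *)

Require Import Defs.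
From mathcomp Require Import all_boot zify.
From mathcomp Require Import order ssralg ssrnum ring Rstruct.
Set Implicit Arguments. Unset Strict Implicit. Unset Printing Implicit Defensive.

Lemma card_bigcup_le (I V : finType) (P : pred I) (F : I -> {set V}) :
  #|\bigcup_(i | P i) F i| <= \sum_(i | P i) #|F i|.
Proof.
elim/big_rec2: _ => [|i k A _ le]; first by rewrite cards0.
by apply: leq_trans (leq_card_setU _ _) _; rewrite leq_add2l.
Qed.

(** * A block without a large rainbow matching *)

Section Block.
Variables r m : nat.
Hypothesis r_ge3 : 2 < r.

(* In the block of [p], the two big edges [inl true] and [inl false] use the vertices [inl (inl (p i))] of
   part [i] and [inl (inr (p i))] of part [ordS i], for all [i].  The local edge [inr (i, q)] contains both
   vertices with index [lift (p i) q] that belong to [i], and is padded with the vertices [inr (i, q)] of the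
   other parts; two local edges with the same [(i, q)] meet because there is such a part. *)
Definition slot := ('I_m.+1 + 'I_m.+1 + 'I_r * 'I_m)%type.
Definition kind := (bool + 'I_r * 'I_m)%type.

Definition place (p : {ffun 'I_r -> 'I_m.+1}) (k : kind) (j : 'I_r) : slot :=
  match k with
  | inl true => inl (inl (p j))
  | inl false => inl (inr (p (ord_pred j)))
  | inr (i, q) =>
    if j == i then inl (inl (lift (p i) q))
    else if j == ordS i then inl (inr (lift (p i) q))
    else inr (i, q)
  end.

Lemma ordS_neq (i : 'I_r) : (ordS i == i) = false.
Proof.
apply/negP => /eqP /(congr1 val) /=; case: i => i /= lt_ir.
have [e|ne] := eqVneq i.+1 r; first by rewrite e modnn; lia.
by rewrite modn_small; lia.
Qed.

(** For [r > 2], part [ordS (ordS i)] is a third one besides [i] and [ordS i]; there the local edges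
    of [i] show only their padding [inr (i, q)]. *)
Lemma ordSS_neq (i : 'I_r) : (ordS (ordS i) == i) = false.
Proof.
apply/negP => /eqP /(congr1 val) /=; case: i => i /= lt_ir.
have [e|ne] := eqVneq i.+1 r.
  by rewrite e modnn modn_small; lia.
rewrite (@modn_small i.+1); last by lia.
have [e|ne2] := eqVneq i.+2 r; first by rewrite e modnn; lia.
by rewrite modn_small; lia.
Qed.

(** This makes the edges of a block with the same [p] a matching: [lift (p i)] is injective and
    misses [p i], so local edges of [i] avoid each other and the big edges. *)
Lemma place_inj p j : injective (place p ^~ j).
Proof.
move=> [[]|[i q]] [[]|[i' q']] //=;
  do ?case: ifP => [/eqP ?|?]; do ?case: ifP => [/eqP ?|?] //; subst => //.
all: try by move=> [] /eqP; rewrite ?(negbTE (neq_lift _ _)) // eq_sym (negbTE (neq_lift _ _)).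
all: try by rewrite ?ordSK; move=> [] /eqP;
  rewrite ?(negbTE (neq_lift _ _)) // eq_sym (negbTE (neq_lift _ _)).
- by move=> e; congr (inr (_, _)); apply: (@lift_inj _ (p i')); congruence.
- match goal with H : ordS _ = ordS _ |- _ => move: (can_inj (@ordSK r) H) => -> end.
  by move=> e; congr (inr (_, _)); apply: (@lift_inj _ (p i')); congruence.
- by move=> [-> ->].
Qed.

(* With [a] and [b] big edges of the two kinds, at most [m + 1 - max 1 a b] local edges belong to any [i];
   since [r > 2], size [r m + 2] forces [a = b = 1].  Two big edges of different [p] differ at some [i],
   where they leave room for only [m - 1] local edges. *)
Lemma block_bound (S : {set kind * {ffun 'I_r -> 'I_m.+1}}) :
  {in S &, injective snd} ->
  (forall x y, x \in S -> y \in S -> x != y ->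
     forall j, place x.2 x.1 j != place y.2 y.1 j) ->
  #|S| <= r * m + 1.
Proof.
move=> injS disjS.
have sameS x y j : x \in S -> y \in S ->
    place x.2 x.1 j = place y.2 y.1 j -> x = y.
  move=> xS yS e; apply/eqP; apply: contraTT isT => ne.
  by move: (disjS x y xS yS ne j); rewrite e eqxx.
pose D b := [set x in S | x.1 == inl b].
pose L i := [set x in S | if x.1 is inr (i', _) then i' == i else false].
have cardS : #|S| <= #|D true| + #|D false| + \sum_i #|L i|.
  apply: (@leq_trans #|D true :|: D false :|: \bigcup_i L i|).
    apply/subset_leq_card/subsetP => -[[[]|[i q]] p] xS; rewrite !inE ?xS //=.
    by apply/bigcupP; exists i => //; rewrite inE xS /=.
  apply: leq_trans (leq_card_setU _ _) _; apply: leq_add; first exact: leq_card_setU.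
  exact: card_bigcup_le.
(* These are the indices taken at [i] by the big edges of kind [b] and, in [W i], by the local
   edges. A big edge uses one of the two vertices with its index, a local edge both; so [W i] avoids
   [V true i] and [V false i], which may overlap. *)
pose V b i := [set x.2 i | x : kind * {ffun 'I_r -> 'I_m.+1} in D b].
pose lv i (x : kind * {ffun 'I_r -> 'I_m.+1}) :=
  if x.1 is inr (_, q) then lift (x.2 i) q else ord0.
pose W i := [set lv i x | x in L i].
have cardV b i : #|V b i| = #|D b|.
  apply: card_in_imset => x y; rewrite !inE => /andP[xS /eqP ex] /andP[yS /eqP ey] exy.
  case: b ex ey => ex ey; first by apply: (sameS _ _ i) => //; rewrite ex ey /= exy.
  by apply: (sameS _ _ (ordS i)) => //; rewrite ex ey /= ordSK exy.
have inL i x : x \in L i -> exists q p, x = (inr (i, q), p) /\ x \in S.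
  case: x => [[b|[i' q]] p]; rewrite inE /= ?andbF // => /andP[xS /eqP e].
  by subst i'; exists q, p.
have cardW i : #|W i| = #|L i|.
  apply: card_in_imset => x y /inL[q1 [p1 [-> xS]]] /inL[q2 [p2 [-> yS]]].
  rewrite /lv /= => e.
  by apply: (sameS _ _ i) => //=; rewrite !eqxx e.
have cardL i : #|L i| <= m.
  pose g (x : kind * {ffun 'I_r -> 'I_m.+1}) := if x.1 is inr (_, q) then Some q else None.
  rewrite -(@card_in_imset _ _ g (L i)).
    have eq_m : #|[set Some q | q in 'I_m]| = m.
      by rewrite card_imset ?card_ord //; apply: Some_inj.
    rewrite -[X in _ <= X]eq_m.
    apply/subset_leq_card/subsetP => _ /imsetP[x /inL[q [p [-> _]]] ->].
    by apply/imsetP; exists q.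
  move=> x y /inL[q1 [p1 [-> xS]]] /inL[q2 [p2 [-> yS]]] [e]; subst q2.
  apply: (sameS _ _ (ordS (ordS i))) => //=.
  by rewrite ordSS_neq ordS_neq.
have disjWV b i : [disjoint W i & V b i].
  rewrite -setI_eq0; apply/eqP/setP => v; rewrite [RHS]inE; apply/negP.
  rewrite inE => /andP[/imsetP[x /inL[q1 [p1 [-> xS]]] ->]] /imsetP[[k p2]].
  rewrite inE /= => /andP[yS /eqP ek]; subst k.
  rewrite /lv /= => e; suff: (inr (i, q1) : kind, p1) = (inl b : kind, p2) by [].
  case: b yS => yS; first by apply: (sameS _ _ i) => //=; rewrite eqxx e.
  by apply: (sameS _ _ (ordS i)) => //=; rewrite ordS_neq eqxx ordSK e.
have bound i : #|L i| + #|V true i :|: V false i| <= m.+1.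
  rewrite -(cardW i) -cardsUI.
  have -> : W i :&: (V true i :|: V false i) = set0.
    by rewrite setIUr !(disjoint_setI0 (disjWV _ _)) setU0.
  by rewrite cards0 addn0 -[X in _ <= X](card_ord m.+1) max_card.
have bound_V b i : #|D b| <= #|V true i :|: V false i|.
  by rewrite -(cardV b i); apply/subset_leq_card; case: b; [apply: subsetUl | apply: subsetUr].
apply: leq_trans cardS _.
have sum_le k : (forall i, #|L i| <= k) -> \sum_i #|L i| <= r * k.
  by move=> le; rewrite -[X in X * k](card_ord r) -sum_nat_const leq_sum.
have [big|small] := boolP ((1 < #|D true|) || (1 < #|D false|)).
  (* The total is at most [2 M + r (m + 1 - M)], hence at most [r m + 1], because
     [(r - 2) M >= r - 1] for [r >= 3] and [M >= 2]. *)
  pose M := maxn #|D true| #|D false|.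
  have le_M i : #|L i| <= m.+1 - M.
    have := bound i; have := bound_V true i; have := bound_V false i; rewrite /M; lia.
  have := sum_le _ le_M; have i0 : 'I_r by exact: (Ordinal (ltnW (ltnW r_ge3))).
  have := bound i0; have := bound_V true i0; have := bound_V false i0.
  move: big; rewrite /M; nia.
have := sum_le _ cardL.
have [|lt2] := leqP (#|D true| + #|D false|) 1; first by lia.
have /eqP/cards1P[x Dx] : #|D true| = 1 by lia.
have /eqP/cards1P[y Dy] : #|D false| = 1 by lia.
have : x \in D true by rewrite Dx inE.
have : y \in D false by rewrite Dy inE.
rewrite !inE => /andP[yS /eqP ey] /andP[xS /eqP ex] _.
have [i ne_i] : exists i, x.2 i != y.2 i.
  apply/existsP; apply: contraTT isT; rewrite negb_exists => /forallP eq2.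
  have e : x = y by apply: injS => //; apply/ffunP => i; apply/eqP; rewrite -[_ == _]negbK eq2.
  by move: ex; rewrite e ey.
have Li : #|L i| < m.
  have := bound i; rewrite /V Dx Dy !imset_set1 cards2 ne_i; lia.
rewrite Dx Dy !cards1 (bigD1 i) //=.
have : \sum_(i0 | i0 != i) #|L i0| <= r.-1 * m.
  have <- : #|[pred i0 : 'I_r | i0 != i]| = r.-1 by rewrite (cardC1 i) card_ord.
  by rewrite -sum_nat_const leq_sum.
have -> : r * m = r.-1 * m + m by rewrite -{1}(prednK (ltnW (ltnW r_ge3))) mulSn addnC.
move=> le_rest; apply: (@leq_trans (1 + 1 + (#|L i| + r.-1 * m))); first by rewrite !leq_add2l.
by move: Li; lia.
Qed.

(** * Disjoint copies of the block *)

Section Copies.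
Variable k : nat.

Definition edge (p : {ffun 'I_r -> 'I_m.+1}) (x : 'I_k * kind) :
    {set 'I_k * ('I_r * slot)} :=
  [set (x.1, (j, place p x.2 j)) | j in 'I_r].

Lemma edge_meet p p' x x' : ~~ [disjoint edge p x & edge p' x'] ->
  x.1 = x'.1 /\ exists j, place p x.2 j = place p' x'.2 j.
Proof.
case/pred0Pn => v /andP[/imsetP[j _ ->] /imsetP[j' _ [-> <- e]]].
by split=> //; exists j.
Qed.

Lemma meet_edge p p' b c c' j : place p c j = place p' c' j ->
  ~~ [disjoint edge p (b, c) & edge p' (b, c')].
Proof.
move=> e; apply/pred0Pn; exists (b, (j, place p c j)); apply/andP; split.
  by apply/imsetP; exists j.
by apply/imsetP; exists j => //=; rewrite e.
Qed.

Lemma edge_disjoint p x x' : x != x' -> [disjoint edge p x & edge p x'].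
Proof.
apply: contraR => /edge_meet[e1 [j /place_inj e2]].
by apply/eqP; case: x x' e1 e2 => [b c] [b' c'] /= -> ->.
Qed.

Lemma edge_inj p : injective (edge p).
Proof.
move=> x x' e; apply/eqP; apply: contraT => /(edge_disjoint p).
rewrite e -setI_eq0 setIid => /eqP e0.
have: (x'.1, (Ordinal (ltnW (ltnW r_ge3)), place p x'.2 (Ordinal (ltnW (ltnW r_ge3)))))
   \in edge p x' by apply/imsetP; eexists.
by rewrite e0 inE.
Qed.

Lemma card_edge p x : #|edge p x| = r.
Proof. by rewrite card_imset ?card_ord // => i j []. Qed.

(** The colours are distinct functions [p], all using the same [s] of the [k (r m + 2)] pairs of
    copy and kind. [block_bound] in each copy caps a rainbow matching at [k (r m + 1)]. *)
Lemma not_good_copies n s : n <= m.+1 ^ r -> k * (r * m + 1) < n ->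
  s <= k * (r * m + 2) -> ~ good true r n s.
Proof.
move=> le_n lt_n le_s gd.
have card_F : #|{ffun 'I_r -> 'I_m.+1}| = m.+1 ^ r by rewrite card_ffun !card_ord.
have le_n' : n <= #|{: {ffun 'I_r -> 'I_m.+1}}| by rewrite card_F.
pose col i : {ffun 'I_r -> 'I_m.+1} := enum_val (widen_ord le_n' i).
have col_inj : injective col by move=> i j /enum_val_inj /(congr1 val) /= /val_inj.
pose I0 : {set 'I_k * kind} := [set x in take s (enum [set: 'I_k * kind])].
have card_I0 : #|I0| = s.
  rewrite cardsE (card_uniqP _) ?take_uniq ?enum_uniq // size_takel // -cardE cardsT.
  rewrite !card_prod card_sum card_prod !card_ord card_bool; lia.
pose Ms i := [set edge (col i) x | x in I0].
have union_E e : e \in union_edges Ms -> exists p x, e = edge p x.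
  by case/bigcupP => i _ /imsetP[x _ ->]; exists (col i), x.
have [||||R [[mR [_ [phi [phi_inj phiR]]]] cR]] := gd _ Ms.
- move=> i _ _ /imsetP[x _ ->] /imsetP[y _ ->] ne.
  by apply: edge_disjoint; apply: contraNneq ne => ->.
- by move=> i; rewrite card_imset //; apply: edge_inj.
- by move=> e /union_E[p [x ->]]; rewrite card_edge.
- move=> _; exists (fun v => v.2.1) => e /union_E[p [x ->]] i.
  rewrite -(cards1 (x.1, (i, place p x.2 i))); apply: eq_card => v.
  rewrite !inE; apply/andP/eqP => [[/imsetP[j _ ->] /= /eqP ->]|->] //.
  by split=> //; apply/imsetP; exists i.
(* An edge may belong to several colours; it is recorded with the function of the colour that [phi]
   gives it, so that injectivity of [phi] becomes that of [snd]. *)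
pose S b := [set y : kind * {ffun 'I_r -> 'I_m.+1} |
  [exists e in R, (e == edge y.2 (b, y.1)) && (y.2 == col (phi e))]].
have inS b y : y \in S b -> edge y.2 (b, y.1) \in R /\ y.2 = col (phi (edge y.2 (b, y.1))).
  by rewrite inE => /exists_inP[e eR /andP[/eqP <- /eqP]].
have S_inj b : {in S b &, injective snd}.
  move=> [c p] [c' p'] /inS /= [eR e1] /inS /= [eR' e2] /= e; subst p'.
  by have [->] := edge_inj (phi_inj _ _ eR eR' (col_inj _ _ (etrans (esym e1) e2))).
have S_disj b x y : x \in S b -> y \in S b -> x != y ->
     forall j, place x.2 x.1 j != place y.2 y.1 j.
  move=> xS yS ne j; apply: contraNneq ne => /(meet_edge b) meet; apply/eqP.
  have [[eR e1] [eR' e2]] := (inS _ _ xS, inS _ _ yS).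
  apply: (S_inj b) => //; rewrite e1 e2; congr (col (phi _)).
  by apply/eqP; apply: contraNT meet; apply: mR.
suff: #|R| <= \sum_(b < k) #|S b|.
  rewrite cR => le; have : \sum_(b < k) #|S b| <= \sum_(b < k) (r * m + 1).
    by apply: leq_sum => b _; apply: block_bound; [apply: S_inj | apply: S_disj].
  by rewrite sum_nat_const card_ord => le'; move: (leq_trans le le'); rewrite leqNgt lt_n.
apply: (@leq_trans #|\bigcup_(b < k) [set edge y.2 (b, y.1) | y in S b]|).
  apply/subset_leq_card/subsetP => e eR; have /imsetP[[b c] _ ee] := phiR e eR.
  apply/bigcupP; exists b => //; apply/imsetP; exists (c, col (phi e)) => //=.
  by rewrite inE; apply/exists_inP; exists e => //; rewrite -ee !eqxx.
by apply: leq_trans (card_bigcup_le _ _) _; apply: leq_sum => b _; apply: leq_imset_card.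
Qed.

End Copies.
End Block.

(* Bollobás' set-pair inequality, with a cruder bound. *)
Lemma set_pair_bound (V I : finType) (S : {set I}) (A B : I -> {set V}) a b :
  {in S, forall i, #|A i| <= a} -> {in S, forall i, #|B i| <= b} ->
  {in S, forall i, [disjoint A i & B i]} ->
  {in S &, forall i j, i != j -> ~~ [disjoint A i & B j]} -> #|S| <= a.+1 ^ b.
Proof.
elim: b S B => [|b IH] S B leA leB disjAB crossAB.
  rewrite expn0; apply/card_le1_eqP => i j iS jS; apply/eqP; apply: contraT => ne.
  have /eqP : #|B i| == 0 by rewrite -leqn0 leB.
  by move/cards0_eq => B0; move: (crossAB j i jS iS ne); rewrite B0 -setI_eq0 setI0 eqxx.
have [->|[c cS]] := set_0Vmem S; first by rewrite cards0.
rewrite (cardsD1 c) cS.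
(* Every [B j] with [j != c] meets [A c]. The [j] with a fixed [v] of [A c] in [B j] keep all
   hypotheses when [v] is deleted from [B j], as [v] lies in none of their [A j]. Hence
   [#|S| <= 1 + a (a + 1) ^ b]. *)
have cover : S :\ c \subset \bigcup_(v in A c) [set j in S :\ c | v \in B j].
  apply/subsetP => j; rewrite !inE => /andP[ne jS].
  have /pred0Pn[v /andP[vA vB]] := crossAB c j cS jS (contraNneq (fun e => introT eqP (esym e)) ne).
  by apply/bigcupP; exists v => //; rewrite !inE ne jS.
have le_v v : v \in A c -> #|[set j in S :\ c | v \in B j]| <= a.+1 ^ b.
  move=> vA; apply: (IH _ (fun j => B j :\ v)) => [j|j|j|i j]; rewrite !inE.
  - by move=> /andP[/andP[_ jS] _]; apply: leA.
  - move=> /andP[/andP[_ jS] vB]; have := leB j jS.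
    by rewrite (cardsD1 v) vB.
  - move=> /andP[/andP[_ jS] vB]; apply: disjointWr (disjAB j jS); exact: subsetDl.
  - move=> /andP[/andP[_ iS] vBi] /andP[/andP[_ jS] vBj] ne.
    have /pred0Pn[w /andP[wA wB]] := crossAB i j iS jS ne.
    apply/pred0Pn; exists w; apply/andP; split=> //; move: wA wB; rewrite !inE => wA ->; rewrite andbT.
    apply: contraTneq wA => ->.
    by have /pred0P/(_ v) := disjAB i iS; rewrite /= vBi andbT => ->.
have := leq_trans (subset_leq_card cover) (card_bigcup_le _ _).
have := leq_sum (index_enum V) le_v; rewrite sum_nat_const => le1 le2.
have := leq_mul (leA c cS) (leqnn (a.+1 ^ b)).
have : 0 < a.+1 ^ b by rewrite expn_gt0.
rewrite expnS mulSn; move: (leq_trans le2 le1); lia.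
Qed.

(** * Matchings meeting a vertex set *)

Lemma card_set_sum (T : finType) (A : {pred T}) (P : pred T) :
  #|[set x in A | P x]| = \sum_(x in A) P x.
Proof.
rewrite -sum1_card big_mkcond [RHS]big_mkcond; apply: eq_bigr => x _.
by rewrite inE; case: (x \in A); case: (P x).
Qed.

Lemma sum_card_matching (V : finType) (F : {set {set V}}) (X : {set V}) :
  matching F -> \sum_(f in F) #|f :&: X| <= #|X|.
Proof.
move=> mF; under eq_bigr do rewrite -sum1_card.
rewrite (exchange_big_dep (mem X)) /=; last by move=> f v _ /setIP[].
rewrite -sum1_card; apply: leq_sum => v vX; rewrite sum1_card.
apply/card_le1_eqP => f g /andP[fF /setIP[vf _]] /andP[gF /setIP[vg _]].
apply/eqP; apply: contraT => ne; have /pred0P/(_ v) := mF g f gF fF ne.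
by rewrite /= vf vg.
Qed.

Lemma card_matching_meet (V : finType) (F : {set {set V}}) (X : {set V}) :
  matching F -> {in F, forall f : {set V}, ~~ [disjoint f & X]} -> #|F| <= #|X|.
Proof.
move=> mF meet; apply: leq_trans (sum_card_matching X mF).
rewrite -sum1_card; apply: leq_sum => f fF.
by rewrite card_gt0 setI_eq0 meet.
Qed.

Lemma matchingS (V : finType) (F G : {set {set V}}) :
  F \subset G -> matching G -> matching F.
Proof. by move=> /subsetP sFG mG f g /sFG fG /sFG; apply: mG. Qed.

(** * Augmenting partial rainbow matchings *)

Section PartialRainbow.
Variables (V : finType) (n r : nat) (M : 'I_n -> {set {set V}}).
Hypothesis matchM : forall i, matching (M i).
Hypothesis unifM : forall i f, f \in M i -> #|f| = r.

(** A partial rainbow matching is encoded by its used colours [C] and an edge for each; values of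
    [rho] outside [C] are arbitrary. *)
Definition prainbow (C : {set 'I_n}) (rho : 'I_n -> {set V}) :=
  {in C, forall c, rho c \in M c} /\
  {in C &, forall c c', c != c' -> [disjoint rho c & rho c']}.

Lemma prainbow_add C rho u f : prainbow C rho -> u \notin C -> f \in M u ->
  {in C, forall c : 'I_n, [disjoint f & rho c]} ->
  prainbow (u |: C) (fun c => if c == u then f else rho c).
Proof.
move=> [inM disj] uC fM fdisj; split=> [c|c c']; rewrite !inE.
  by case: eqP => [->|_ /inM].
case: (eqVneq c u) => [->|nc]; case: (eqVneq c' u) => [->|nc'] //=.
- by move=> _ /fdisj.
- by move=> /fdisj; rewrite disjoint_sym.
- exact: disj.
Qed.

Lemma card_bigcup_prainbow (C D : {set 'I_n}) rho : D \subset C -> prainbow C rho ->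
  #|\bigcup_(c in D) rho c| <= #|D| * r.
Proof.
move=> /subsetP sDC [inM _]; apply: leq_trans (card_bigcup_le _ _) _.
rewrite -sum_nat_const; apply: leq_sum => c /sDC cC.
by rewrite (unifM (inM c cC)).
Qed.

Variables (s D l : nat).
Hypothesis le_s : forall i, s <= #|M i|.
Hypothesis le_D : r * n + n + D <= 2 * s.
Hypothesis lt_l : r.+1 ^ r * n * r.-1 < l * D.

Lemma prainbow_augment C rho : prainbow C rho -> #|C| + l <= n ->
  exists C' rho', prainbow C' rho' /\ #|C'| = #|C|.+1.
Proof.
move=> prb le_l; have [inM disj] := prb.
pose W := \bigcup_(c in C) rho c.
have subW c : c \in C -> rho c \subset W by move=> cC; apply: bigcup_sup.
have [/existsP[u /andP[uC /existsP[f /andP[fM fW]]]]|] :=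
  boolP [exists u, (u \notin C) && [exists f, (f \in M u) && [disjoint f & W]]].
  exists (u |: C), (fun c => if c == u then f else rho c); split; last by rewrite cardsU1 uC.
  by apply: prainbow_add => // c /subW sub; apply: disjointWr fW.
rewrite negb_exists => /forallP meet.
have {}meet u f : u \notin C -> f \in M u -> ~~ [disjoint f & W].
  move=> uC fM; move: (meet u); rewrite uC negb_exists => /forallP/(_ f).
  by rewrite fM.
(* An edge of [F u] meets only one edge of the partial matching, so one in [G u c] conflicts with
   [rho c] alone. For [c] in [T u], colour [u] offers two such edges. *)
pose F u := [set f in M u | #|f :&: W| == 1].
pose G u c := [set f in F u | ~~ [disjoint f & rho c]].
pose T u := [set c in C | 1 < #|G u c|].
have G_disj u c x f : c \in C -> x \in C -> x != c -> f \in G u c -> [disjoint f & rho x].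
  move=> cC xC ne; rewrite !inE => /andP[/andP[_ /cards1P[v ev]] /pred0Pn[w /andP[wf wc]]].
  apply: contraT => /pred0Pn[z /andP[zf zx]].
  have : w \in f :&: W by apply/setIP; split=> //; apply: (subsetP (subW c cC)).
  have : z \in f :&: W by apply/setIP; split=> //; apply: (subsetP (subW x xC)).
  rewrite ev !inE => /eqP ez /eqP ew; move: zx wc; rewrite /= ez ew => vx vc.
  by have /pred0P/(_ v) := disj x c xC cC ne; rewrite /= vx vc.
have GM u c f : f \in G u c -> f \in M u by rewrite !inE => /andP[/andP[]].
have matchG u c : matching (G u c).
  have sub : G u c \subset M u.
    by apply/subsetP => f fG; apply: GM fG.
  exact (matchingS sub (@matchM u)).
have card_C : #|C| <= n by rewrite -[X in _ <= X](card_ord n) max_card.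
have le_F u : u \notin C -> n + D <= #|F u|.
  move=> uC; have := card_bigcup_prainbow (subxx C) prb.
  have := sum_card_matching W (@matchM u); rewrite -/W => le1 le2.
  (* Edges of [F u] count once in the sum and once in [#|F u|], all others at least twice in the
     sum, which is at most [#|W| <= r n]. *)
  have : 2 * #|M u| <= \sum_(f in M u) #|f :&: W| + #|F u|.
    rewrite card_set_sum -big_split /= mulnC -sum_nat_const; apply: leq_sum => f fM.
    have : 0 < #|f :&: W| by rewrite card_gt0 setI_eq0 (meet u).
    by case: #|f :&: W| => [|[|k]].
  have := leq_mul card_C (leqnn r); have := le_s u; move: le1 le2 le_D.
  rewrite [n * r]mulnC; lia.
have le_T u : u \notin C -> D <= #|T u| * r.-1.
  move=> uC; have le_G c : c \in C -> #|G u c| <= r.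
    move=> cC; rewrite -(unifM (inM c cC)); apply: card_matching_meet => // f.
    by rewrite inE => /andP[].
  have cover : F u \subset \bigcup_(c in C) G u c.
    apply/subsetP => f fF; have := fF; rewrite inE => /andP[fM _].
    have /pred0Pn[v /andP[vf /bigcupP[c cC vc]]] := meet u f uC fM.
    by apply/bigcupP; exists c => //; rewrite inE fF; apply/pred0Pn; exists v; apply/andP.
  have := leq_trans (subset_leq_card cover) (card_bigcup_le _ _).
  (* Each [c] accounts for at most one edge of [F u], or for up to [r <= 1 + r.-1] if it is in
     [T u]. *)
  have : \sum_(c in C) #|G u c| <= #|C| + #|T u| * r.-1.
    rewrite card_set_sum -sum1_card big_distrl -big_split /=; apply: leq_sum => c cC.
    by have le_r := le_G c cC; case: (ltnP 1 #|G u c|) => le1;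
      [rewrite mul1n add1n; apply: leq_trans le_r (leqSpred r) | rewrite mul0n addn0].
  have := le_F u uC; move: card_C; lia.
(* Double counting of the pairs [(u, c)] with [c] in [T u]: their number times [r.-1] is at least
   [l D]. *)
have [c cC lt_c] : exists2 c, c \in C & r.+1 ^ r < #|[set u in ~: C | c \in T u]|.
  apply/exists_inP; apply: contraLR lt_l; rewrite negb_exists_in -leqNgt => /forall_inP le_c.
  have card_nC : l <= #|~: C| by rewrite cardsCs setCK card_ord; move: le_l; lia.
  apply: (@leq_trans ((\sum_(u in ~: C) #|T u|) * r.-1)).
    apply: (@leq_trans (#|~: C| * D)); first by rewrite leq_mul2r card_nC orbT.
    rewrite -sum_nat_const big_distrl /=; apply: leq_sum => u; rewrite inE; exact: le_T.
  rewrite leq_mul2r; apply/orP; right.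
  under eq_bigr do rewrite -sum1_card.
  rewrite (exchange_big_dep (mem C)) /=; last by move=> u c _; rewrite inE => /andP[].
  apply: (@leq_trans (\sum_(c in C) r.+1 ^ r)).
    apply: leq_sum => c cC; have := le_c c cC; rewrite -leqNgt; apply: leq_trans.
    by rewrite -[X in _ <= X]sum1_card; apply/eq_leq/eq_bigl => u; rewrite [in RHS]inE.
  by rewrite sum_nat_const mulnC leq_mul2l card_C orbT.
set S := [set u in ~: C | c \in T u] in lt_c.
(* The default is never taken for [u] in [S], where [G u c] has two edges. *)
pose pr u := odflt (set0, set0)
  [pick x : {set V} * {set V} | [&& x.1 \in G u c, x.2 \in G u c & x.1 != x.2]].
have prP u : u \in S -> [&& (pr u).1 \in G u c, (pr u).2 \in G u c & (pr u).1 != (pr u).2].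
  move=> /setIdP[_ /setIdP[_ /card_gt1P[f [g [fG gG ne]]]]].
  rewrite /pr; case: pickP => [x //|/(_ (f, g))].
  by rewrite /= fG gG ne.
have [u [v [uS vS ne dis]]] : exists u v, [/\ u \in S, v \in S, u != v &
    [disjoint (pr u).1 & (pr v).2]].
  pose good_pair u v := [&& u \in S, v \in S, u != v & [disjoint (pr u).1 & (pr v).2]].
  suff /existsP[u /existsP[v /and4P[]]] : [exists u, exists v, good_pair u v] by exists u, v.
  (* Without such [u] and [v], the pairs [pr u] would satisfy the crossing hypothesis of
     [set_pair_bound], forcing [#|S| <= (r + 1) ^ r]. *)
  apply: contraLR lt_c => none; rewrite -leqNgt.
  apply: (@set_pair_bound _ _ S (fun u => (pr u).1) (fun u => (pr u).2)).
  - by move=> u /prP/and3P[/GM/unifM ->].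
  - by move=> u /prP/and3P[_ /GM/unifM ->].
  - by move=> u /prP/and3P[p1 p2]; apply: (matchG u c).
  move=> u v uS vS ne; apply: contra none => dis; apply/existsP; exists u; apply/existsP; exists v.
  exact/and4P.
have /and3P[pu _ _] := prP u uS; have /and3P[_ pv _] := prP v vS.
have prb0 : prainbow (C :\ c) rho.
  by split=> [x|x y]; rewrite !inE => /andP[_ xC]; [apply: inM | move=> /andP[_ yC]; apply: disj].
have uC : u \notin C by move: uS; rewrite !inE => /andP[].
have vC : v \notin C by move: vS; rewrite !inE => /andP[].
have prb1 : prainbow (v |: C :\ c) (fun x => if x == v then (pr v).2 else rho x).
  apply: prainbow_add => //; first by rewrite !inE (negbTE vC) andbF.
    exact: GM pv.
  by move=> x; rewrite !inE => /andP[nx xC]; apply: G_disj pv.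
eexists; eexists; split.
  apply: (prainbow_add prb1 (u := u) (f := (pr u).1)).
  - by rewrite !inE (negbTE uC) andbF orbF.
  - exact: GM pu.
  move=> x; rewrite !inE; case: eqP => [_ _ //|_ /= /andP[nx xC]].
  by apply: G_disj pu.
rewrite !cardsU1 !inE (negbTE uC) (negbTE vC) !andbF orbF ne /=.
by rewrite (cardsD1 c C) cC.
Qed.

Lemma large_prainbow : exists C rho, prainbow C rho /\ n < #|C| + l.
Proof.
suff grow k : k <= n.+1 - l -> exists C rho, prainbow C rho /\ k <= #|C|.
  by have [C [rho [prb card_C]]] := grow _ (leqnn _); exists C, rho; split=> //; lia.
elim: k => [|k IH] le_k.
  by exists set0, (fun=> set0); split=> //; split=> [c|c c']; rewrite inE.
have [C [rho [prb card_C]]] := IH (ltnW le_k).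
have [lt|le] := ltnP k #|C|; first by exists C, rho.
have [|C' [rho' [prb' e]]] := prainbow_augment prb; first by lia.
by exists C', rho'; split=> //; lia.
Qed.

End PartialRainbow.

(** * Completing inside the reserved set *)

Section Completion.
Variables (V : finType) (n r : nat) (M : 'I_n -> {set {set V}}) (U : {set V}).
Hypothesis matchM : forall i, matching (M i).
Hypothesis unifM : forall i f, f \in M i -> #|f| = r.
Hypothesis r_gt0 : 0 < r.

(** Before each greedy step fewer than [#|~: C|] edges have been added, covering fewer than
    [#|~: C| * r] vertices, and each vertex spoils at most one edge of the next colour. *)
Lemma prainbow_complete C rho : prainbow M C rho ->
  {in C, forall c : 'I_n, [disjoint rho c & U]} ->
  (forall i, #|~: C| * r <= #|[set f in M i | f \subset U]|) ->
  exists rho', prainbow M setT rho'.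
Proof.
move=> prb disjU many.
suff grow k : k <= #|~: C| -> exists (C' : {set 'I_n}) rho',
    [/\ C \subset C', prainbow M C' rho', #|C'| = #|C| + k &
        {in C, forall c : 'I_n, [disjoint rho' c & U]}].
  have [C' [rho' [_ prb' card_C' _]]] := grow _ (leqnn _).
  suff <- : C' = setT by exists rho'.
  by apply/eqP; rewrite eqEcard subsetT cardsT -(cardsC C) card_C' leqnn.
elim: k => [|k IH] le_k; first by exists C, rho; rewrite addn0; split.
have [C' [rho' [sub prb' card_C' disjU']]] := IH (ltnW le_k).
have [u uC'] : exists u, u \notin C'.
  apply/existsP; apply: contraLR le_k; rewrite negb_exists => /forallP full.
  have eT : C' = setT by apply/setP => u; rewrite inE; move: (full u); rewrite negbK.
  by move: card_C'; rewrite eT cardsT -(cardsC C) => /eqP; rewrite eqn_add2l => /eqP ->; rewrite ltnn.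
pose X := \bigcup_(c in C' :\: C) rho' c.
have [f [fM fU fX]] : exists f, [/\ f \in M u, f \subset U & [disjoint f & X]].
  pose N := [set f in M u | f \subset U].
  suff /exists_inP[f /setIdP[fM fU] fX] : [exists f in N, [disjoint f & X]] by exists f.
  apply: contraT; rewrite negb_exists_in => /forall_inP meet.
  have matchN : matching N.
    have sN : N \subset M u by apply/subsetP => f /setIdP[].
    exact (matchingS sN (@matchM u)).
  have := card_matching_meet matchN meet.
  have := card_bigcup_prainbow unifM (subsetDl C' C) prb'.
  have := many u; rewrite -/N -/X cardsD (setIidPr sub) card_C' addKn => le1 le2 le3.
  have := leq_trans le1 (leq_trans le3 le2).
  by rewrite leq_pmul2r // leqNgt le_k.
have fdisj : {in C', forall c : 'I_n, [disjoint f & rho' c]}.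
  move=> c cC'; case: (boolP (c \in C)) => [/disjU'|cC].
    by rewrite disjoint_sym; apply: disjointWl.
  by apply: disjointWr fX; apply: bigcup_sup; rewrite inE cC.
exists (u |: C'), (fun c => if c == u then f else rho' c); split.
- exact: subset_trans sub (subsetUr _ _).
- exact: prainbow_add.
- by rewrite cardsU1 uC' card_C' addnS.
move=> c cC; case: eqP => [e|_]; last exact: disjU'.
by move: uC'; rewrite -e (subsetP sub).
Qed.

(** Since [r > 0], an edge shared by two colours would be disjoint from itself; so [rho] is
    injective and [phi] inverts it, with an arbitrary default off its image. *)
Lemma rainbow_of_prainbow rho : 0 < n -> prainbow M setT rho ->
  exists R, rainbow M R /\ #|R| = n.
Proof.
move=> n_gt0 [inM disj].
have rho_inj : injective rho.
  move=> i j e; apply/eqP; apply: contraT => /(disj i j (in_setT i) (in_setT j)).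
  rewrite e -setI_eq0 setIid -cards_eq0 (unifM (inM j (in_setT j))) => /eqP r0.
  by move: r_gt0; rewrite r0.
exists [set rho i | i in 'I_n]; split; last by rewrite card_imset ?card_ord.
split; [|split].
- move=> _ _ /imsetP[i _ ->] /imsetP[j _ ->] ne; apply: disj => //.
  by apply: contraNneq ne => ->.
- by apply/subsetP => _ /imsetP[i _ ->]; apply/bigcupP; exists i => //; apply: inM.
pose phi e := odflt (Ordinal n_gt0) [pick i | rho i == e].
have rhoK i : phi (rho i) = i.
  rewrite /phi; case: pickP => [j /eqP /rho_inj //|/(_ i)].
  by rewrite eqxx.
exists phi; split=> [_ _ /imsetP[i _ ->] /imsetP[j _ ->]|_ /imsetP[i _ ->]]; rewrite !rhoK.
  by move=> ->.
exact: inM.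
Qed.

End Completion.

Lemma rainbow_of_reserve (V : finType) n r (M : 'I_n -> {set {set V}}) (U : {set V}) s y D l :
  0 < r -> 0 < n -> (forall i, matching (M i)) ->
  (forall i f, f \in M i -> #|f| = r) -> (forall i, #|M i| = s) ->
  (forall i, l * r <= #|[set f in M i | f \subset U]|) ->
  (forall i, #|[set f in M i | ~~ [disjoint f & U]]| <= y) ->
  r * n + n + D <= 2 * (s - y) -> r.+1 ^ r * n * r.-1 < l * D ->
  exists R, rainbow M R /\ #|R| = n.
Proof.
move=> r_gt0 n_gt0 mM uM cM inU touchU le_D lt_l.
pose M' i := [set f in M i | [disjoint f & U]].
have sub i : M' i \subset M i by apply/subsetP => f /setIdP[].
have mM' i : matching (M' i) by move=> f g fM gM; apply: (mM i); apply: (subsetP (sub i)).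
have uM' i f : f \in M' i -> #|f| = r by move=> /(subsetP (sub i)) /uM.
have le_M' i : s - y <= #|M' i|.
  rewrite leq_subLR -(cM i) -(cardsID [set f : {set V} | [disjoint f & U]] (M i)) addnC leq_add //.
    apply: leq_trans (touchU i); apply/subset_leq_card/subsetP => f.
    by rewrite !inE => /andP[-> ->].
  by apply/subset_leq_card/subsetP => f; rewrite !inE.
have [C [rho [prb lt_C]]] := large_prainbow mM' uM' le_M' le_D lt_l.
have [|||rho' prb'] := @prainbow_complete _ _ _ _ U mM uM r_gt0 C rho.
- by case: prb => inM disj; split=> // c /inM /(subsetP (sub c)).
- by case: prb => inM _ c /inM /setIdP[].
- move=> i; apply: leq_trans (inU i); rewrite leq_mul2r; apply/orP; right.
  by rewrite cardsCs setCK card_ord; move: lt_C; lia.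
exact: (rainbow_of_prainbow uM r_gt0 n_gt0 prb').
Qed.

(** * Random choice of the reserved set *)

Section RandomSet.
Import Order.TTheory GRing.Theory Num.Theory.
Local Open Scope ring_scope.
Variable F : realFieldType.

(** Disjoint edges give independent factors. The weights [c] and [d] are prescribed only on vertices
    of [M], so that the induction can absorb the product over a removed edge into them. *)
Lemma expectation_matching (V : finType) (M : {set {set V}}) r (q a b al be : F)
    (c d : V -> F) :
  matching M -> uniform r M ->
  (forall f v, f \in M -> v \in f -> c v = q /\ d v = 1 - q) ->
  \sum_(U : {set V}) (\prod_v (if v \in U then c v else d v)) *
     \prod_(f in M) (al + be * \prod_(v in f) (if v \in U then a else b))
  = (\prod_v (c v + d v)) * (al + be * (q * a + (1 - q) * b) ^+ r) ^+ #|M|.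
Proof.
elim: {M}#|M| {-2}M (erefl #|M|) c d => [|k IH] M card_M c d mM uM cd.
  rewrite card_M expr0 mulr1 bigA_distr; apply: eq_bigr => U _.
  by rewrite (cards0_eq card_M) big_set0 mulr1.
have [f fM] : exists f, f \in M by apply/card_gt0P; rewrite card_M.
have mM' : matching (M :\ f).
  by move=> g h /setD1P[_ gM] /setD1P[_ hM]; apply: mM.
have uM' : uniform r (M :\ f) by move=> g /setD1P[_ gM]; apply: uM.
have card_M' : #|M :\ f| = k by move: card_M; rewrite (cardsD1 f) fM => -[].
pose c' v := c v * (if v \in f then a else 1).
pose d' v := d v * (if v \in f then b else 1).
transitivity (al * (\sum_(U : {set V}) (\prod_v (if v \in U then c v else d v)) *
     \prod_(g in M :\ f) (al + be * \prod_(v in g) (if v \in U then a else b))) +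
  be * (\sum_(U : {set V}) (\prod_v (if v \in U then c' v else d' v)) *
     \prod_(g in M :\ f) (al + be * \prod_(v in g) (if v \in U then a else b)))).
  rewrite !big_distrr -big_split; apply: eq_bigr => U _ /=.
  rewrite (big_setD1 f) //=.
  have -> : \prod_v (if v \in U then c' v else d' v) =
     (\prod_v (if v \in U then c v else d v)) * \prod_(v in f) (if v \in U then a else b).
    rewrite [X in _ * X]big_mkcond -big_split; apply: eq_bigr => v _ /=.
    by rewrite /c' /d'; case: (v \in U); case: (v \in f).
  by ring.
rewrite (IH _ card_M') //; last by move=> g v /setD1P[_ gM]; apply: cd.
rewrite (IH _ card_M') //; last first.
  move=> g v /setD1P[ne gM] vg.
  have /pred0P/(_ v) := mM g f gM fM ne; rewrite /= vg /= /c' /d' => vf.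
  by have [-> ->] := cd g v gM vg; rewrite vf !mulr1.
have -> : \prod_v (c' v + d' v) = (\prod_v (c v + d v)) * (q * a + (1 - q) * b) ^+ r.
  rewrite -(uM f fM) -prodr_const [X in _ * X]big_mkcond -big_split /=.
  apply: eq_bigr => v _; rewrite /c' /d'; case: ifP => vf; last by rewrite !mulr1.
  by have [-> ->] := cd f v fM vf; ring.
by rewrite card_M' card_M exprS; ring.
Qed.

Lemma prod_indicator (V : finType) (P : pred V) (f : {set V}) :
  \prod_(v in f) (if P v then 1 else 0 : F) = ([forall v in f, P v])%:R.
Proof.
case: forall_inP => [all|none]; first by apply: big1 => v /all ->.
have [v vf nP] : exists2 v, v \in f & ~~ P v.
  apply/exists_inP; apply: contraT; rewrite negb_exists_in => /forall_inP all.
  by case: none => v /all; rewrite negbK.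
by rewrite (bigD1 v) //= (negbTE nP) mul0r.
Qed.

Lemma prod_const_indicator (T : finType) (A : {set T}) (P : pred T) (t : F) :
  \prod_(x in A) (if P x then t else 1) = t ^+ #|[set x in A | P x]|.
Proof.
rewrite -prodr_const big_mkcond [RHS]big_mkcond; apply: eq_bigr => x _.
by rewrite inE; case: (x \in A); case: (P x).
Qed.

(* First moment method applied to [2^x sum_i 2^(- X_i) + 2^(- y) sum_i 2^(Y_i)], where [X_i] counts the
   edges of [M i] inside a [q]-random vertex set [U] and [Y_i] those meeting [U]. *)
Lemma reserve_exists (V : finType) n r s x y (M : 'I_n -> {set {set V}}) (q : F) :
  0 <= q <= 1 -> (forall i, matching (M i)) -> (forall i, uniform r (M i)) ->
  (forall i, #|M i| = s) ->
  n%:R * (2 ^+ x * (1 - q ^+ r / 2) ^+ s + (2 - (1 - q) ^+ r) ^+ s / 2 ^+ y) < 1 ->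
  exists U : {set V},
    (forall i, x <= #|[set f in M i | f \subset U]|)%N /\
    (forall i, #|[set f in M i | ~~ [disjoint f & U]]| <= y)%N.
Proof.
move=> /andP[q_ge0 q_le1] mM uM cM small.
pose pr (U : {set V}) : F := \prod_v (if v \in U then q else 1 - q).
have pr_ge0 U : 0 <= pr U by apply: prodr_ge0 => v _; case: ifP => _; rewrite ?subr_ge0.
pose X i (U : {set V}) := #|[set f in M i | f \subset U]|.
pose Y i (U : {set V}) := #|[set f in M i | ~~ [disjoint f & U]]|.
have q1 : \prod_(v : V) (q + (1 - q)) = 1 by rewrite big1 // => v _; apply: subrKC.
have EX i : \sum_U pr U * 2^-1 ^+ X i U = (1 - q ^+ r / 2) ^+ s.
  (* The product over [f] is the indicator of [f \subset U], so the factor is [2^-1] or [1]. *)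
  have := @expectation_matching V (M i) r q 1 0 1 (- 2^-1) (fun=> q) (fun=> 1 - q) (mM i) (uM i)
    (fun _ _ _ _ => conj erefl erefl).
  rewrite /= cM q1 mul1r mulr1 mulr0 addr0 mulNr mulrC => <-; apply: eq_bigr => U _; congr (_ * _).
  rewrite /X -prod_const_indicator; apply: eq_bigr => f _.
  rewrite prod_indicator; have -> : [forall v in f, v \in U] = (f \subset U).
    by apply/forall_inP/subsetP.
  by case: (f \subset U) => /=; field.
have EY i : \sum_U pr U * 2 ^+ Y i U = (2 - (1 - q) ^+ r) ^+ s.
  (* The product over [f] is the indicator of [f] being disjoint from [U], so the factor is [1] or
     [2]. *)
  have := @expectation_matching V (M i) r q 0 1 2 (- 1) (fun=> q) (fun=> 1 - q) (mM i) (uM i)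
    (fun _ _ _ _ => conj erefl erefl).
  rewrite /= cM q1 mul1r mulr1 mulr0 add0r mulN1r => <-; apply: eq_bigr => U _; congr (_ * _).
  rewrite /Y -prod_const_indicator; apply: eq_bigr => f _.
  have -> : \prod_(v in f) (if v \in U then 0 else 1) = \prod_(v in f) (if v \notin U then 1 else 0 : F).
    by apply: eq_bigr => v _; case: (v \in U).
  rewrite prod_indicator; have -> : [forall v in f, v \notin U] = [disjoint f & U].
    apply/forall_inP/pred0P => [all v|all v vf]; last by move: (all v); rewrite /= vf /= => ->.
    by apply/andP => -[/all/negP].
  by case: [disjoint _ & _] => /=; ring.
pose Phi (U : {set V}) : F := \sum_i (2 ^+ x * 2^-1 ^+ X i U + 2 ^+ Y i U / 2 ^+ y).
have EPhi : \sum_U pr U * Phi U < 1.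
  have -> : \sum_U pr U * Phi U =
      n%:R * (2 ^+ x * (1 - q ^+ r / 2) ^+ s + (2 - (1 - q) ^+ r) ^+ s / 2 ^+ y); last by [].
  under eq_bigr do rewrite big_distrr.
  rewrite exchange_big /= -[n in RHS](card_ord n) mulr_natl -sumr_const; apply: eq_bigr => i _.
  rewrite -(EX i) -(EY i) big_distrr big_distrl -big_split; apply: eq_bigr => U _ /=.
  by rewrite mulrDr mulrCA [X in _ + X]mulrA.
have sum_pr : \sum_U pr U = 1.
  by rewrite -bigA_distr.
have /existsP[U lt1] : [exists U, Phi U < 1].
  apply: contraLR EPhi; rewrite negb_exists => /forallP ge1.
  rewrite -leNgt -sum_pr; apply: ler_sum => U _.
  by rewrite ler_peMr // leNgt.
have ge0 i : 0 <= 2 ^+ x * 2^-1 ^+ X i U :> F by rewrite mulr_ge0 ?exprn_ge0 ?invr_ge0.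
have ge0' i : 0 <= 2 ^+ Y i U / 2 ^+ y :> F by rewrite mulr_ge0 ?invr_ge0 ?exprn_ge0.
have lt1i i : 2 ^+ x * 2^-1 ^+ X i U + 2 ^+ Y i U / 2 ^+ y < 1 :> F.
  apply: le_lt_trans lt1; rewrite /Phi (bigD1 i) //= lerDl sumr_ge0 // => j _.
  by rewrite addr_ge0.
exists U; split=> i.
  have lt : 2 ^+ x * 2^-1 ^+ X i U < 1 :> F by apply: le_lt_trans (lt1i i); rewrite lerDl.
  apply: contraLR lt; rewrite -ltnNge -leNgt exprVn => /ltnW le.
  by rewrite ler_pdivlMr ?exprn_gt0 // mul1r ler_eXn2l // ltr1n.
have lt : 2 ^+ Y i U / 2 ^+ y < 1 :> F by apply: le_lt_trans (lt1i i); rewrite lerDr.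
apply: contraLR lt; rewrite -ltnNge -leNgt => /ltnW le.
by rewrite ler_pdivlMr ?exprn_gt0 // mul1r ler_eXn2l // ltr1n.
Qed.

End RandomSet.

(* Real estimates and minimality *)
From Stdlib Require Import ZArith Reals Lra ClassicalEpsilon.
Local Open Scope R_scope.

Lemma nat_ceil x : 0 <= x -> exists k : nat, x <= INR k <= x + 1.
Proof.
move=> x_ge0; have [lt le] := archimed x.
exists (Z.to_nat (up x)); rewrite INR_IZR_INZ Z2Nat.id; first by lra.
by apply: le_IZR; lra.
Qed.

Lemma nat_floor x : 0 <= x -> exists k : nat, x - 1 < INR k <= x.
Proof.
move=> x_ge0; have [lt le] := archimed x.
exists (Z.to_nat (up x - 1)); rewrite INR_IZR_INZ Z2Nat.id ?minus_IZR; first by lra.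
have : (0 < up x)%Z by apply: lt_IZR; lra.
by lia.
Qed.

(** Writing [x] as [z ^ k] turns the fractional powers of the theorem into natural powers of [z]. *)
Lemma Rpower_root x k : 0 < x -> (0 < k)%nat ->
  exists z, [/\ 0 < z, z ^ k = x & Rpower x ((INR k - 1) / INR k) = z ^ k.-1].
Proof.
move=> x_gt0 k_gt0; have k_gt0' : 0 < INR k by apply: lt_0_INR; lia.
exists (Rpower x (/ INR k)); split; first exact: exp_pos.
  rewrite -Rpower_pow; last exact: exp_pos.
  by rewrite Rpower_mult Rinv_l ?Rpower_1 //; lra.
rewrite -Rpower_pow; last exact: exp_pos.
rewrite Rpower_mult; congr (Rpower _ _).
have -> : INR k = INR k.-1 + 1 by rewrite -S_INR prednK.
have := pos_INR k.-1; move=> ?; field; lra.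
Qed.

Lemma pow_ltS u v k : 0 < u < v -> u ^ k.+1 < v ^ k.+1.
Proof.
move=> [u_gt0 lt_uv]; elim: k => [|k IH]; first by rewrite !pow_1.
rewrite -[u ^ k.+2]/(u * u ^ k.+1) -[v ^ k.+2]/(v * v ^ k.+1).
by apply: Rmult_gt_0_lt_compat => //; [apply: pow_lt | lra].
Qed.

(** With [K = k + 1], [exp z = exp (z / K) ^ K > (z / K) ^ K], and the spare factor [z] beats
    [2 * K ^ K]. *)
Lemma exp_gt_pow k : exists Z, forall z, Z <= z -> 2 * z ^ k < exp z.
Proof.
set K := INR k.+1.
have K_gt0 : 0 < K by apply: lt_0_INR; lia.
have Kk_gt0 : 0 < K ^ k.+1 by apply: pow_lt.
exists (2 * K ^ k.+1) => z le_z; have z_gt0 : 0 < z by lra.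
have zk_gt0 : 0 < z ^ k by apply: pow_lt.
have -> : exp z = exp (z / K) ^ k.+1.
  rewrite -Rpower_pow; last exact: exp_pos.
  by rewrite /Rpower ln_exp -/K; congr exp; field; lra.
apply: Rle_lt_trans (_ : (z / K) ^ k.+1 < _).
  rewrite Rpow_mult_distr pow_inv /=.
  apply: (Rmult_le_reg_r (K ^ k.+1)) => //.
  rewrite -[K * K ^ k]/(K ^ k.+1) !Rmult_assoc Rinv_l; last by lra.
  rewrite Rmult_1_r; nra.
have zK : 0 < z / K by apply: Rdiv_lt_0_compat.
apply: Rlt_le_trans (_ : (1 + z / K) ^ k.+1 <= _); first by apply: pow_ltS; lra.
apply: pow_incr; split; first by lra.
by apply: exp_ineq1_le.
Qed.

(** [epsilon] is meaningful only if some good size exists, so even the lower bound on [h] relies on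
    the size found for the upper bound. *)
Lemma hmin_spec b r n s : good b r n s ->
  good b r n (hmin b r n) /\ forall t, good b r n t -> (hmin b r n <= t)%nat.
Proof.
move=> gs; apply: (epsilon_spec (inhabits 0%nat)
  (fun s => good b r n s /\ forall t, good b r n t -> (s <= t)%nat)).
have [m] : exists m, (s < m)%nat by exists s.+1.
elim: m s gs => [//|m IH] s gs lt_sm.
have [[t [gt lt_ts]]|none] := classic (exists t, good b r n t /\ (t < s)%nat).
  by apply: IH gt _; apply: leq_trans lt_ts _.
exists s; split=> // t gt; rewrite leqNgt; apply/negP => lt; apply: none.
by exists t.
Qed.

Lemma good_partite r n s : good false r n s -> good true r n s.
Proof. by move=> g V Ms mM cM uM _; apply: g. Qed.

Lemma INR_expn a b : INR (expn a b) = INR a ^ b.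
Proof. by elim: b => [|b IH]; [rewrite expn0 | rewrite expnS mult_INR IH]. Qed.

Lemma root_large Z k : 0 <= Z -> exists N : nat, forall n z, (N <= n)%nat ->
  0 < z -> z ^ k.+1 = INR n -> Z <= z.
Proof.
move=> Z_ge0; have [N [leN _]] := nat_ceil (pow_le Z k.+1 Z_ge0).
exists N => n z /leP/le_INR le_n z_gt0 e.
by apply: Rnot_lt_le => lt; have := @pow_ltS z Z k (conj z_gt0 lt); lra.
Qed.

(** * Lower bound *)

Lemma good_lower r : (2 < r)%nat -> exists N : nat, forall n t, (N <= n)%nat ->
  good true r n t ->
  INR n + Rpower (INR n) ((INR r - 1) / INR r) / (12 * INR r) <= INR t.
Proof.
move=> r_ge3; have rho_ge3 : 3 <= INR r by have := le_INR 3 r (elimT leP r_ge3); rewrite /=; lra.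
set rho := INR r in rho_ge3 *.
have [|N large] := @root_large (12 * rho ^ 2) r.-1; first by nra.
exists (maxn N 1) => n t; rewrite geq_max => /andP[le_N n_gt0] gd.
have n_gt0' : 0 < INR n by apply: lt_0_INR; lia.
have [z [z_gt0 zr ->]] := Rpower_root n_gt0' (ltnW (ltnW r_ge3)).
have le_z : 12 * rho ^ 2 <= z by apply: (large n) => //; rewrite prednK //; lia.
set P := z ^ r.-1.
have n_P : INR n = z * P by rewrite -zr /P -[in LHS](prednK (ltnW (ltnW r_ge3))).
have z_ge1 : 1 <= z by nra.
have le_P : z ^ 2 <= P by apply: Rle_pow => //; lia.
(* Since [z < m + 1], there are at least [n] functions [p]. [w] bounds a rainbow matching in one
   block, and [k] is the number of copies, chosen with [k w < n]. *)
have [m [lt_m le_m]] := nat_floor (Rlt_le _ _ z_gt0).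
set w := rho * INR m + 1.
have m_ge0 := pos_INR m.
have w_gt0 : 0 < w by rewrite /w; nra.
have le_w : w <= 2 * rho * z by rewrite /w; nra.
have n_ge1 : 1 <= INR n by apply: (le_INR 1); apply/leP.
have [|k [lt_k le_k]] := @nat_floor ((INR n - 1) / w).
  by apply: Rmult_le_pos; [lra | left; apply: Rinv_0_lt_compat].
have kw : INR k * w <= INR n - 1.
  by apply: (Rmult_le_reg_r (/ w)); [apply: Rinv_0_lt_compat | rewrite Rmult_assoc Rinv_r; lra].
have kw' : INR n - 1 - w < INR k * w.
  have : (INR n - 1) / w * w < (INR k + 1) * w by apply: Rmult_lt_compat_r; lra.
  by rewrite /Rdiv Rmult_assoc Rinv_l; lra.
have INR_w : INR (r * m + 1)%nat = w by rewrite plus_INR mult_INR.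
have lt_t : INR k * (w + 1) + 1 <= INR t.
  have lt : (k * (r * m + 2) < t)%nat.
    rewrite ltnNge; apply/negP => le_t; apply: (not_good_copies r_ge3 _ _ le_t gd).
      apply/leP/INR_le; rewrite INR_expn -zr; apply: pow_incr.
      by rewrite S_INR; lra.
    by apply/ltP/INR_lt; rewrite mult_INR INR_w; lra.
  move/ltP/le_INR: lt; rewrite S_INR mult_INR.
  have -> : (r * m + 2 = (r * m + 1).+1)%nat by lia.
  by rewrite S_INR INR_w.
have k_large : P / (2 * rho) - 2 <= INR k.
  have : P / (2 * rho) - 1 <= (INR n - 1) / w; last by lra.
  apply: Rle_trans (_ : (INR n - 1) / (2 * rho * z) <= _).
    have -> : (INR n - 1) / (2 * rho * z) = P / (2 * rho) - / (2 * rho * z).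
      by rewrite n_P; field; lra.
    have : / (2 * rho * z) <= / 1 by apply: Rinv_le_contravar; nra.
    by lra.
  by apply: Rmult_le_compat_l; [lra | apply: Rinv_le_contravar].
(* The bounds so far give [t > n + k - w] with [k - w >= P / (2 rho) - 2 - (rho z + 1)]; the loss
   [rho z + 3] fits into the five spare multiples of [P / (12 rho)]. *)
have P12 : P / (2 * rho) - P / (12 * rho) = 5 * (P / (12 * rho)) by field; lra.
have : rho * z <= P / (12 * rho).
  apply: (Rmult_le_reg_r (12 * rho)); first by lra.
  have -> : P / (12 * rho) * (12 * rho) = P by field; lra.
  by nra.
have : 1 <= rho * z by nra.
move: lt_t; rewrite Rmult_plus_distr_l; lra.
Qed.

(** * Upper bound *)

Lemma reserve_exists_R (V : finType) n r s x y (M : 'I_n -> {set {set V}}) q :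
  0 <= q <= 1 -> (forall i, matching (M i)) -> (forall i, uniform r (M i)) ->
  (forall i, #|M i| = s) ->
  INR n * (2 ^ x * (1 - q ^ r / 2) ^ s + (2 - (1 - q) ^ r) ^ s / 2 ^ y) < 1 ->
  exists U : {set V},
    (forall i, x <= #|[set f in M i | f \subset U]|)%nat /\
    (forall i, #|[set f in M i | ~~ [disjoint f & U]]| <= y)%nat.
Proof.
move=> [q_ge0 q_le1] mM uM cM small.
apply: (@reserve_exists _ V n r s x y M q) => //.
  by apply/andP; split; apply/RleP.
apply/RltP; rewrite -!RpowE -INRE.
have -> : GRing.natmul (GRing.one _ : R) 2 = 2 by rewrite -INRE.
exact: small.
Qed.

Lemma exp_nat_mul a k : exp (INR k * a) = exp a ^ k.
Proof.
rewrite -Rpower_pow; last exact: exp_pos.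
by rewrite /Rpower ln_exp.
Qed.

Lemma bernoulli_sub q k : 0 <= q <= 1 -> 1 - INR k * q <= (1 - q) ^ k.
Proof.
move=> [q_ge0 q_le1]; elim: k => [|k IH]; first by rewrite /=; lra.
rewrite S_INR /=; have := pos_INR k; have : 0 <= INR k * (q * q) by have := pos_INR k; nra.
by nra.
Qed.

Lemma pow2_le_exp k : 2 ^ k <= exp (INR k).
Proof.
rewrite -[INR k]Rmult_1_r exp_nat_mul; apply: pow_incr; split; first by lra.
by have := exp_ineq1_le 1; lra.
Qed.

Lemma exp_half_le_pow2 k : exp (INR k / 2) <= 2 ^ k.
Proof.
rewrite exp_nat_mul; apply: pow_incr; split; first by left; apply: exp_pos.
apply: Rle_trans (_ : exp (ln 2) <= _); last by rewrite exp_ln; lra.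
by left; apply: exp_increasing; exact: ln_lt_2.
Qed.

(** Both terms are at most [exp (- z)]; the second because [2 - (1 - q) ^ r <= 1 + r q <= exp (r q)]
    and [exp (y / 2) <= 2 ^ y]. *)
Lemma tail_bound n r s x y q z : 0 <= q <= 1 -> 2 * INR n < exp z ->
  INR x + z <= INR s * (q ^ r / 2) ->
  4 * (INR s * (INR r * q)) <= INR y -> z <= INR s * (INR r * q) ->
  INR n * (2 ^ x * (1 - q ^ r / 2) ^ s + (2 - (1 - q) ^ r) ^ s / 2 ^ y) < 1.
Proof.
move=> q01 lt_n le_x le_y le_z; have [q_ge0 q_le1] := q01.
have qr_ge0 : 0 <= q ^ r by apply: pow_le.
have qr_le1 : q ^ r <= 1 by rewrite -[X in _ <= X](pow1 r); apply: pow_incr.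
have pr_le1 : (1 - q) ^ r <= 1 by rewrite -[X in _ <= X](pow1 r); apply: pow_incr; lra.
have ez_gt0 := exp_pos z; have enz_gt0 := exp_pos (- z).
have n_ge0 := pos_INR n.
have first_le : 2 ^ x * (1 - q ^ r / 2) ^ s <= exp (- z).
  apply: Rle_trans (_ : exp (INR x) * exp (INR s * - (q ^ r / 2)) <= _).
    apply: Rmult_le_compat; [apply: pow_le; lra | apply: pow_le; lra | exact: pow2_le_exp |].
    rewrite exp_nat_mul; apply: pow_incr; split; first by lra.
    by have := exp_ineq1_le (- (q ^ r / 2)); lra.
  rewrite -exp_plus; apply: Rnot_lt_le => /exp_lt_inv; lra.
have second_le : (2 - (1 - q) ^ r) ^ s / 2 ^ y <= exp (- z).
  apply: Rle_trans (_ : exp (INR s * (INR r * q)) * / exp (INR y / 2) <= _).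
    apply: Rmult_le_compat; [apply: pow_le; lra | | |].
    - by left; apply: Rinv_0_lt_compat; apply: pow_lt; lra.
    - rewrite exp_nat_mul; apply: pow_incr; split; first by lra.
      by have := bernoulli_sub r q01; have := exp_ineq1_le (INR r * q); lra.
    by apply: Rinv_le_contravar; [exact: exp_pos | exact: exp_half_le_pow2].
  rewrite -exp_Ropp -exp_plus; apply: Rnot_lt_le => /exp_lt_inv; lra.
apply: Rle_lt_trans (_ : INR n * (2 * exp (- z)) < _).
  by apply: Rmult_le_compat_l; lra.
have : exp z * exp (- z) = 1 by rewrite -exp_plus Rplus_opp_r exp_0.
nra.
Qed.

Lemma good_upper r : (2 < r)%nat -> exists N : nat, forall n, (N <= n)%nat ->
  exists s, good false r n s /\
    INR s <= (INR r + 1) * INR n / 2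
       + 3 * INR r ^ 2 * Rpower (INR n) ((2 * INR r - 1) / (2 * INR r)).
Proof.
move=> r_ge3; have rho_ge3 : 3 <= INR r by have := le_INR 3 r (elimT leP r_ge3); rewrite /=; lra.
set rho := INR r in rho_ge3 *.
pose Kn := (expn r.+1 r * r.-1)%nat; set K := INR Kn.
have K_ge0 : 0 <= K := pos_INR Kn.
have [Z1 largeZ1] := exp_gt_pow (2 * r)%nat.
set c := rho * (K + 2) + 1.
have c_gt0 : 0 < c by rewrite /c; nra.
have pow5 : 1 <= 5 ^ r by apply: pow_R1_Rle; lra.
(* The last three thresholds serve in turn for [s <= rho n], for [2 n < exp z], and for enough edges
   inside [U]. *)
set Z0 := Rmax 3 (Rmax (3 * rho ^ 2) (Rmax Z1 (2 * 5 ^ r * c))).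
have Z0_ge : [/\ 3 <= Z0, 3 * rho ^ 2 <= Z0, Z1 <= Z0 & 2 * 5 ^ r * c <= Z0].
  have max_ge a b d : d <= b -> d <= Rmax a b by move=> le; apply: Rle_trans le (Rmax_r _ _).
  split; [exact: Rmax_l | apply: max_ge; exact: Rmax_l | |].
    by apply/max_ge/max_ge; exact: Rmax_l.
  by apply/max_ge/max_ge; exact: Rmax_r.
have [Z0_3 Z0_rho Z0_1 Z0_c] := Z0_ge.
have r2_gt0 : (0 < 2 * r)%nat by lia.
have [|N large] := @root_large Z0 (2 * r).-1; first by lra.
exists (maxn N 1) => n; rewrite geq_max => /andP[le_N n_gt0].
have n_gt0' : 0 < INR n by apply: lt_0_INR; lia.
have [z [z_gt0 zr]] := Rpower_root n_gt0' r2_gt0.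
have -> : INR (2 * r) = 2 * rho by rewrite mult_INR.
move=> ->; set P := z ^ (2 * r).-1.
have le_z : Z0 <= z by apply: (large n) => //; rewrite prednK.
have {large} z_ge3 : 3 <= z by lra.
have n_P : INR n = z * P by rewrite -zr /P -[in LHS](prednK r2_gt0).
have le_P : z ^ 2 <= P by apply: Rle_pow; [lra | lia].
set B := (rho + 1) * INR n / 2 + 3 * rho ^ 2 * P.
have B_ge0 : 0 <= B by rewrite /B; nra.
have [s [lt_s le_s]] := nat_floor B_ge0.
exists s; split=> //.
have [|Q [le_Q Q_le]] := @nat_ceil (4 * z); first by lra.
set q := / INR Q.
have q_gt0 : 0 < q by apply: Rinv_0_lt_compat; lra.
have q_ge : / (5 * z) <= q by apply: Rinv_le_contravar; lra.
have q_le : q <= / (4 * z) by apply: Rinv_le_contravar; lra.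
have P_ge : 9 <= P by nra.
have s_ge : INR n <= INR s by move: lt_s; rewrite /B n_P; nra.
have s_le : INR s <= rho * INR n.
  have : 3 * rho ^ 2 * P <= INR n by rewrite n_P; apply: Rmult_le_compat_r; lra.
  by move: le_s; rewrite /B; nra.
(* Losing [y] edges costs about [2 rho^2 P] of the [6 rho^2 P] by which [2 s] exceeds [(r + 1) n],
   which leaves room for [D]. *)
have [|y [le_y y_le]] := @nat_ceil (rho ^ 2 * P); first by nra.
have [D [le_D D_le]] := @nat_ceil P ltac:(lra).
have [l0 [le_l0 l0_le]] := @nat_ceil (K * z) ltac:(nra).
(* The extra 1 makes [K n < l D] strict, as [K n = K z P <= l0 D]. *)
pose l := l0.+1; have INR_l : INR l = INR l0 + 1 by rewrite S_INR.
have q_le1 : q <= 1.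
  by apply: Rle_trans q_le _; rewrite -Rinv_1; apply: Rinv_le_contravar; lra.
have sq_le : 4 * (INR s * (rho * q)) <= rho ^ 2 * P.
  apply: Rle_trans (_ : 4 * (rho * INR n * (rho * / (4 * z))) <= _).
    apply: Rmult_le_compat_l; first by lra.
    apply: Rmult_le_compat => //; [exact: pos_INR | nra |].
    by apply: Rmult_le_compat_l; lra.
  by right; rewrite n_P; field; lra.
have sq_ge : z <= INR s * (rho * q).
  apply: Rle_trans (_ : INR n * (3 * / (5 * z)) <= _).
    have -> : INR n * (3 * / (5 * z)) = 3 / 5 * P by rewrite n_P; field; lra.
    by nra.
  have inv_gt0 : 0 < / (5 * z) by apply: Rinv_0_lt_compat; lra.
  apply: Rmult_le_compat => //; [lra | lra |].
  by apply: Rmult_le_compat; lra.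
(* The left side is at most [c z], linear in [z], while the right side is at least
   [z ^ r / (2 * 5 ^ r)]. *)
have x_le : INR (l * r) + z <= INR s * (q ^ r / 2).
  apply: Rle_trans (_ : c * z <= _).
    by rewrite mult_INR INR_l -/rho /c; nra.
  have zr_gt0 : 0 < z ^ r by apply: pow_lt.
  apply: Rle_trans (_ : INR n * (/ (5 * z) ^ r / 2) <= _).
    have -> : INR n * (/ (5 * z) ^ r / 2) = z ^ r / (2 * 5 ^ r).
      have -> : INR n = z ^ r * z ^ r by rewrite -zr -Rdef_pow_add; congr (_ ^ _); lia.
      by rewrite Rpow_mult_distr; field; lra.
    apply: (Rmult_le_reg_r (2 * 5 ^ r)); first by lra.
    have -> : z ^ r / (2 * 5 ^ r) * (2 * 5 ^ r) = z ^ r by field; lra.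
    apply: Rle_trans (_ : z ^ 2 <= _); first by nra.
    by apply: Rle_pow; [lra | lia].
  have inv_gt0 : 0 < / (5 * z) by apply: Rinv_0_lt_compat; lra.
  have pow_gt0 := pow_lt _ r inv_gt0.
  have pow_le_q : (/ (5 * z)) ^ r <= q ^ r by apply: pow_incr; lra.
  by rewrite -pow_inv; apply: Rmult_le_compat; lra.
have lt_exp : 2 * INR n < exp z by rewrite -zr; apply: largeZ1; lra.
move=> V Ms mM cM uM _.
have inM i f : f \in Ms i -> #|f| = r.
  by move=> fM; apply: uM; apply/bigcupP; exists i.
have q01 : 0 <= q <= 1 by lra.
have le_y4 : 4 * (INR s * (rho * q)) <= INR y by lra.
have [U [inU touchU]] := @reserve_exists_R V n r s (l * r) y Ms q q01 mM inM cM
  (tail_bound q01 lt_exp x_le le_y4 sq_ge).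
apply: (@rainbow_of_reserve V n r Ms U s y D l (ltnW (ltnW r_ge3))) => //.
  have le_ys : (y <= s)%nat.
    by apply/leP/INR_le; move: lt_s; rewrite /B n_P; nra.
  apply/leP/INR_le; rewrite !plus_INR !mult_INR minus_INR; last exact/leP.
  rewrite -/rho [INR 0]/0; move: lt_s; rewrite /B; nra.
apply/ltP/INR_lt; rewrite !mult_INR INR_l.
have -> : INR (expn r.+1 r) * INR n * INR r.-1 = K * INR n.
  by rewrite /K /Kn mult_INR; ring.
have : K * z * P <= INR l0 * INR D by apply: Rmult_le_compat => //; [nra | lra].
by rewrite n_P; lra.
Qed.

Theorem theorem1p9 :
  forall r : nat, (3 <= r)%nat ->
  exists N : nat, forall n : nat, (N <= n)%nat ->
    INR n + Rpower (INR n) ((INR r - 1) / INR r) / (12 * INR r)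
       <= INR (h r n) /\
    (h r n <= h' r n)%nat /\
    INR (h' r n) <= (INR r + 1) * INR n / 2
       + 3 * INR r ^ 2 * Rpower (INR n) ((2 * INR r - 1) / (2 * INR r)).
Proof.
move=> r r_ge3; have [N1 lower] := good_lower r_ge3; have [N2 upper] := good_upper r_ge3.
exists (maxn N1 N2) => n; rewrite geq_max => /andP[le_N1 le_N2].
have [s [gs le_s]] := upper n le_N2.
have [g' min'] := hmin_spec gs.
have [g min] := hmin_spec (good_partite gs).
split; [exact: lower | split; first exact/min/good_partite].
by apply: Rle_trans le_s; apply/le_INR/leP/min'.
Qed.
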